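(* The ordered Ramsey numbers of all ordered graphs without isolated vertices on at most $4$ vertices, other than the orderings of $K_4^-$ ($K_4$ minus an edge), up to reflection, are as follows, where each ordered graph has vertex set $1<2<\dots<m$ ($m\in\{2,3,4\}$) and is given by its edge set: \begin{itemize} \item $K_2$: $\vec R(\{12\})=2$. \item $P_3$: $\vec R(\{13,23\})=4$, $\vec R(\{12,23\})=5$. \item $C_3$: $\vec R(\{12,13,23\})=6$. \item $2K_2$: $\vec R(\{14,23\})=6$, $\vec R(\{13,24\})=5$, $\vec R(\{12,34\})=6$. \item $P_4$: $\vec R(\{14,23,34\})=9$, $\vec R(\{14,23,24\})=7$, $\vec R(\{13,24,34\})=9$, $\vec R(\{13,23,24\})=7$, $\vec R(\{13,14,24\})=7$, $\vec R(\{12,24,34\})=9$, $\vec R(\{12,23,34\})=10$, $\vec R(\{12,14,34\})=10$. \item $K_{1,3}$: $\vec R(\{14,24,34\})=6$, $\vec R(\{13,23,34\})=9$. \item Paw (triangle with a pendant edge): $\vec R(\{14,23,24,34\})=10$, $\vec R(\{13,23,24,34\})=10$, $\vec R(\{13,14,24,34\})=10$, $\vec R(\{13,14,23,34\})=11$, $\vec R(\{12,23,24,34\})=11$, $\vec R(\{12,14,24,34\})=10$. \item $C_4$: $\vec R(\{13,14,23,24\})=10$, $\vec R(\{12,14,23,34\})=14$, $\vec R(\{12,13,24,34\})=11$. \item $K_4$: $\vec R(\{12,13,14,23,24,34\})=18$. \end{itemize}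
   Context: An ordered graph is a graph with a linear order on its vertices. Here $ij$ denotes the edge between vertices $i$ and $j$. The vertices of $K_n$ are linearly ordered as $1<\dots<n$, and a copy of an ordered graph $\mathcal G$ in $K_n$ is a (not necessarily induced) subgraph isomorphic to $\mathcal G$ via an order-preserving map. The ordered Ramsey number $\vec R(\mathcal G)$ is the smallest integer $n$ such that every $2$-edge-coloring of the ordered complete graph $K_n$ contains a copy of $\mathcal G$ all of whose edges have the same color. Reversing the vertex order of $\mathcal G$ (reflection) does not change $\vec R(\mathcal G)$. *)

(* Defs.v *)
From HB Require Import structures.
From mathcomp Require Import all_boot all_order.

Set Implicit Arguments.
Unset Strict Implicit.
Unset Printing Implicit Defensive.

(* The linear order on the vertices is the natural order of 'I_m; the paper's
   vertex k (1 <= k <= m) is the ordinal of value k.-1. *)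
Record ordGraph (m : nat) := OrdGraph {
  adj :> rel 'I_m;
  adj_sym : symmetric adj;
  adj_irr : irreflexive adj }.

Definition edges := seq (nat * nat).

Section GraphOf.
Variables (m : nat) (E : edges).

(* Edge lists use the paper's 1-based vertex names. *)
Definition edge_rel : rel 'I_m := fun i j =>
  (i != j) && (((i.+1, j.+1) \in E) || ((j.+1, i.+1) \in E)).

Lemma edge_rel_sym : symmetric edge_rel.
Proof. by move=> i j; rewrite /edge_rel eq_sym orbC. Qed.

Lemma edge_rel_irr : irreflexive edge_rel.
Proof. by move=> i; rewrite /edge_rel eqxx. Qed.

Definition graph_of : ordGraph m := OrdGraph edge_rel_sym edge_rel_irr.
End GraphOf.

Section Reflection.
Variables (m : nat) (G : ordGraph m).

Definition refl_rel : rel 'I_m := fun i j => G (rev_ord i) (rev_ord j).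

Lemma refl_rel_sym : symmetric refl_rel.
Proof. by move=> i j; apply: adj_sym. Qed.

Lemma refl_rel_irr : irreflexive refl_rel.
Proof. by move=> i; apply: adj_irr. Qed.

Definition reflection : ordGraph m := OrdGraph refl_rel_sym refl_rel_irr.
End Reflection.

Definition no_isolated m (G : ordGraph m) : Prop := forall v, exists w, G v w.

(* Isomorphism of the underlying unordered graphs: G is an ordering of H. *)
Definition ordering_of m n (G : ordGraph m) (H : ordGraph n) : Prop :=
  exists2 f : 'I_m -> 'I_n, bijective f & forall i j, H (f i) (f j) = G i j.

Definition ord_iso m n (G : ordGraph m) (H : ordGraph n) : Prop :=
  exists f : 'I_m -> 'I_n,
    [/\ bijective f, {mono f : i j / i < j}
      & forall i j, H (f i) (f j) = G i j].

Definition same_up_to_reflection m n (G : ordGraph m) (H : ordGraph n) : Prop :=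
  ord_iso G H \/ ord_iso (reflection G) H.

(* The edge between u and v in K_n is the 2-element set [set u; v]; the values
   of a colouring on sets that are not edges are never used. *)
Definition mono_copy m n (G : ordGraph m) (c : {set 'I_n} -> bool) : Prop :=
  exists (f : 'I_m -> 'I_n) (b : bool),
    {mono f : i j / i < j} /\ forall i j, G i j -> c [set f i; f j] = b.

Definition ramsey_for m (G : ordGraph m) (n : nat) : Prop :=
  forall c : {set 'I_n} -> bool, mono_copy G c.

Definition ordered_ramsey_number m (G : ordGraph m) (r : nat) : Prop :=
  ramsey_for G r /\ forall n, ramsey_for G n -> r <= n.

(* A row says that the ordered graph on 1 < ... < nverts with edge set edgeset
   is an ordering of the graph with edge set shape on the same vertices and has
   ordered Ramsey number value. *)
Record row := Row {
  nverts : nat;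
  shape : edges;
  edgeset : edges;
  value : nat }.

Definition row_tuple (x : row) := (nverts x, shape x, edgeset x, value x).
Definition tuple_row (t : nat * edges * edges * nat) :=
  let: (m, F, E, r) := t in Row m F E r.
Lemma row_tupleK : cancel row_tuple tuple_row. Proof. by case. Qed.
HB.instance Definition _ := Equality.copy row (can_type row_tupleK).

Definition row_graph (x : row) : ordGraph (nverts x) :=
  graph_of (nverts x) (edgeset x).
Definition row_shape (x : row) : ordGraph (nverts x) :=
  graph_of (nverts x) (shape x).

Definition K2_edges : edges := [:: (1,2)].
Definition P3_edges : edges := [:: (1,2); (2,3)].
Definition C3_edges : edges := [:: (1,2); (1,3); (2,3)].
Definition twoK2_edges : edges := [:: (1,2); (3,4)].
Definition P4_edges : edges := [:: (1,2); (2,3); (3,4)].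
Definition K13_edges : edges := [:: (1,2); (1,3); (1,4)].
Definition paw_edges : edges := [:: (1,2); (1,3); (2,3); (3,4)].
Definition C4_edges : edges := [:: (1,2); (2,3); (3,4); (1,4)].
Definition K4_edges : edges := [:: (1,2); (1,3); (1,4); (2,3); (2,4); (3,4)].

Definition K4minus : ordGraph 4 :=
  graph_of 4 [:: (1,2); (1,3); (1,4); (2,3); (2,4)].

Definition table : seq row := [::
  Row 2 K2_edges [:: (1,2)] 2;

  Row 3 P3_edges [:: (1,3); (2,3)] 4;
  Row 3 P3_edges [:: (1,2); (2,3)] 5;

  Row 3 C3_edges [:: (1,2); (1,3); (2,3)] 6;

  Row 4 twoK2_edges [:: (1,4); (2,3)] 6;
  Row 4 twoK2_edges [:: (1,3); (2,4)] 5;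
  Row 4 twoK2_edges [:: (1,2); (3,4)] 6;

  Row 4 P4_edges [:: (1,4); (2,3); (3,4)] 9;
  Row 4 P4_edges [:: (1,4); (2,3); (2,4)] 7;
  Row 4 P4_edges [:: (1,3); (2,4); (3,4)] 9;
  Row 4 P4_edges [:: (1,3); (2,3); (2,4)] 7;
  Row 4 P4_edges [:: (1,3); (1,4); (2,4)] 7;
  Row 4 P4_edges [:: (1,2); (2,4); (3,4)] 9;
  Row 4 P4_edges [:: (1,2); (2,3); (3,4)] 10;
  Row 4 P4_edges [:: (1,2); (1,4); (3,4)] 10;

  Row 4 K13_edges [:: (1,4); (2,4); (3,4)] 6;
  Row 4 K13_edges [:: (1,3); (2,3); (3,4)] 9;

  Row 4 paw_edges [:: (1,4); (2,3); (2,4); (3,4)] 10;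
  Row 4 paw_edges [:: (1,3); (2,3); (2,4); (3,4)] 10;
  Row 4 paw_edges [:: (1,3); (1,4); (2,4); (3,4)] 10;
  Row 4 paw_edges [:: (1,3); (1,4); (2,3); (3,4)] 11;
  Row 4 paw_edges [:: (1,2); (2,3); (2,4); (3,4)] 11;
  Row 4 paw_edges [:: (1,2); (1,4); (2,4); (3,4)] 10;

  Row 4 C4_edges [:: (1,3); (1,4); (2,3); (2,4)] 10;
  Row 4 C4_edges [:: (1,2); (1,4); (2,3); (3,4)] 14;
  Row 4 C4_edges [:: (1,2); (1,3); (2,4); (3,4)] 11;

  Row 4 K4_edges [:: (1,2); (1,3); (1,4); (2,3); (2,4); (3,4)] 18 ].

(* Main.v *)
(* Colour the edges of K_n with two colours.  The copies of an ordered graph are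
   the hyperedges of a hypergraph whose vertices are the edges of K_n, and
   R(G) <= n says that this hypergraph has no proper 2-colouring.  For every
   graph but K_4, proper 2-colourings are excluded by backtracking: branch on
   the edges of a short list and propagate, where a copy all of whose edges but
   one have the same colour forces the other colour on the remaining edge.  For
   K_4 the recursion R(k,l) <= R(k-1,l) + R(k,l-1), strict if both terms are
   even, gives R(4,4) <= 18.  The lower bounds are explicit colourings.

   That every ordered graph on at most four vertices occurs exactly once is a
   finite check, because an order isomorphism between ordered graphs on the same
   vertices is the identity, so that only edge sets have to be compared. *)

From Stdlib Require Import BinNat.
Require Import Defs.
From mathcomp Require Import all_boot all_order.

Set Implicit Arguments.
Unset Strict Implicit.
Unset Printing Implicit Defensive.

Fixpoint combinations (T : Type) (k : nat) (s : seq T) : seq (seq T) :=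
  match k, s with
  | 0, _ => [:: [::]]
  | _.+1, [::] => [::]
  | k'.+1, x :: s' =>
    [seq x :: t | t <- combinations k' s'] ++ combinations k s'
  end.

Lemma mem_combinations (T : eqType) k (s t : seq T) :
  (t \in combinations k s) = (size t == k) && subseq t s.
Proof.
elim: s k t => [|x s IHs] [|k] [|y t] //.
- by rewrite andbF.
- by rewrite mem_cat IHs orbF; apply/mapP => -[].
rewrite mem_cat IHs /= eqSS.
have -> : (y :: t \in [seq x :: t' | t' <- combinations k s])
          = [&& size t == k, y == x & subseq t s].
  apply/mapP/and3P => [[t' + [-> ->]] | [sz_t /eqP-> sub_t]].
    by rewrite IHs => /andP[].
  by exists t; rewrite ?IHs ?sz_t.
rewrite -andb_orr; congr (_ && _); have [_|//] := eqVneq y x.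
by apply/orb_idr/subseq_trans/subseq_cons.
Qed.

Lemma subseq_iotaE m n s :
  subseq s (iota m n) = sorted ltn s && all (fun i => m <= i < m + n) s.
Proof.
apply/idP/andP => [sub_s | [srt_s lt_s]].
  split; first exact: (subseq_sorted ltn_trans sub_s (iota_ltn_sorted m n)).
  by apply/allP => i /(mem_subseq sub_s); rewrite mem_iota.
suff -> : s = filter (mem s) (iota m n) by exact: filter_subseq.
apply: (irr_sorted_eq ltn_trans ltnn) => // [|i].
  exact: (sorted_filter ltn_trans _ (iota_ltn_sorted m n)).
rewrite mem_filter mem_iota; apply/esym/andb_idr; exact: (allP lt_s).
Qed.

Definition sublists (T : Type) (s : seq T) : seq (seq T) :=
  flatten [seq combinations k s | k <- iota 0 (size s).+1].

Lemma mem_sublists (T : eqType) (s t : seq T) : (t \in sublists s) = subseq t s.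
Proof.
apply/flatten_mapP/idP => [[k _] | sub_t].
  by rewrite mem_combinations => /andP[].
exists (size t); last by rewrite mem_combinations eqxx.
by rewrite mem_iota ltnS size_subseq.
Qed.

Lemma all2_exists (S : eqType) (T : Type) (r : S -> T -> bool) s t x :
  all2 r s t -> x \in s -> exists y, r x y.
Proof.
elim: s t => //= y s IHs [|z t] //= /andP[ryz /IHs{}IHs].
by rewrite inE => /predU1P[->|//]; exists z.
Qed.

(** * Ramsey numbers as colourings of the copies *)

Lemma ramsey_for_leq m (G : ordGraph m) n n' :
  n <= n' -> ramsey_for G n -> ramsey_for G n'.
Proof.
move=> le_n ram c; pose up := widen_ord le_n.
have [f [b [f_mono f_col]]] := ram (fun A => c (up @: A)).
exists (up \o f), b; split=> // i j /f_col <-.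
by rewrite imsetU1 imset_set1.
Qed.

Lemma ordered_ramsey_number_succ m (G : ordGraph m) r :
  ramsey_for G r.+1 -> ~ ramsey_for G r -> ordered_ramsey_number G r.+1.
Proof.
move=> ram no_ram; split=> // n ram_n; rewrite ltnNge; apply/negP => le_n.
exact: no_ram (ramsey_for_leq le_n ram_n).
Qed.

Lemma nth_map_enum_ord (T : Type) (x0 : T) m (f : 'I_m -> T) (i : 'I_m) :
  nth x0 [seq f j | j <- enum 'I_m] i = f i.
Proof. by rewrite (nth_map i) ?size_enum_ord // nth_ord_enum. Qed.

Lemma combinations_iotaP m n s :
  s \in combinations m (iota 0 n) <->
  exists2 f : 'I_m -> 'I_n,
    {mono f : i j / i < j} & s = [seq val (f i) | i <- enum 'I_m].
Proof.
rewrite mem_combinations subseq_iotaE.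
split=> [/and3P[/eqP sz_s srt_s lt_s] | ].
  have lt_nth (i : 'I_m) : nth 0 s i < n.
    by apply: (allP lt_s); rewrite mem_nth ?sz_s.
  exists (fun i => Ordinal (lt_nth i)) => [i j /= | ].
    by apply: (Order.POrderTheory.lt_sorted_ltn_nth 0 srt_s); rewrite inE sz_s.
  apply: (@eq_from_nth _ 0) => [|i]; first by rewrite size_map size_enum_ord.
  by rewrite sz_s => lt_im; rewrite (nth_map_enum_ord _ _ (Ordinal lt_im)).
case=> f f_mono ->; rewrite size_map size_enum_ord eqxx /=; apply/andP; split.
  apply: (homo_sorted (e := relpre val ltn)) => [i j /= | ].
    by rewrite f_mono.
  by rewrite -sorted_map val_enum_ord iota_ltn_sorted.
by apply/allP => _ /mapP[i _ ->]; exact: ltn_ord.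
Qed.

(* The edge between the vertices i < j of K_n, numbered from 0, is the pair
   (i, j); only the values of a colouring at such pairs matter.  The vertices in
   the edge list of an ordered graph are numbered from 1, hence the predecessors
   in [place]. *)
Definition colouring := nat * nat -> bool.

Definition monochromatic (col : colouring) (b : bool) (F : edges) :=
  all (fun e => col e == b) F.

Definition avoids (col : colouring) (Fs : seq edges) :=
  all (fun F => ~~ monochromatic col true F && ~~ monochromatic col false F) Fs.

Lemma avoidsP col Fs :
  reflect (forall F b, F \in Fs -> ~~ monochromatic col b F) (avoids col Fs).
Proof.
apply: (iffP allP) => [no_mono F b /no_mono/andP[] | no_mono F FsF].
  by case: b.
by rewrite !no_mono.
Qed.

Definition place (s : seq nat) (e : nat * nat) : nat * nat :=
  (nth 0 s e.1.-1, nth 0 s e.2.-1).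

Definition copies (m : nat) (E : edges) (n : nat) : seq edges :=
  [seq map (place s) E | s <- combinations m (iota 0 n)].

Definition well_formed (m : nat) (E : edges) :=
  all (fun e => [&& 0 < e.1, e.1 < e.2 & e.2 <= m]) E.

Section Translation.
Variables (m n : nat) (E : edges).
Variables (c : {set 'I_n} -> bool) (col : colouring).
Hypothesis E_wf : well_formed m E.
Hypothesis c_col :
  forall u v : 'I_n, u < v -> c [set u; v] = col (val u, val v).

Lemma monochromatic_place (f : 'I_m -> 'I_n) b : {mono f : i j / i < j} ->
  monochromatic col b (map (place [seq val (f i) | i <- enum 'I_m]) E) <->
  forall i j, graph_of m E i j -> c [set f i; f j] = b.
Proof.
set s := [seq val (f i) | i <- enum 'I_m] => f_mono.
have c_place (i j : 'I_m) :
    i < j -> c [set f i; f j] = col (place s (i.+1, j.+1)).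
  by move=> ij; rewrite /place /= !nth_map_enum_ord c_col ?f_mono.
rewrite /monochromatic all_map; split=> [/allP mono i j | mono].
  wlog ij : i j / i < j => [Gs | Gij].
    case: (ltngtP i j) => [/Gs //|ji Gij|/val_inj->]; last by rewrite adj_irr.
    by rewrite setUC Gs // adj_sym.
  case/andP: Gij => _ /orP[/mono | e_E]; last first.
    by have /and3P[_] := allP E_wf _ e_E; rewrite ltnNge ltnW.
  by move/eqP <-; exact: c_place.
apply/allP => -[[|i] [|j]] e_E; have /and3P[//= _ ij jm] := allP E_wf _ e_E.
rewrite -(c_place (Ordinal (ltn_trans (ltnSE ij) jm)) (Ordinal jm)) //.
by rewrite mono //= /edge_rel -val_eqE /= e_E ltn_eqF.
Qed.

Lemma mono_copyP : mono_copy (graph_of m E) c <-> ~~ avoids col (copies m E n).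
Proof.
split=> [[f [b [f_mono f_col]]] | /allPn[_ /mapP[s s_in ->]]].
  pose s := [seq val (f i) | i <- enum 'I_m].
  have s_in : s \in combinations m (iota 0 n).
    by apply/combinations_iotaP; exists f.
  apply/avoidsP => /(_ _ b (map_f _ s_in))/negP[].
  exact/monochromatic_place.
have [f f_mono ->] := (combinations_iotaP m n s).1 s_in.
rewrite negb_and !negbK => /orP[] /(monochromatic_place _ f_mono) f_col.
  by exists f, true.
by exists f, false.
Qed.
End Translation.

Lemma ramsey_forP m n E : well_formed m E ->
  ramsey_for (graph_of m E) n <-> forall col, ~~ avoids col (copies m E n).
Proof.
move=> E_wf; split=> [ram col | no_av c]; last first.
  pose col e := c [set x : 'I_n | (x == e.1 :> nat) || (x == e.2 :> nat)].
  apply/(mono_copyP E_wf (col := col)) => // u v _.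
  by congr c; apply/setP=> x; rewrite !inE.
pose c (A : {set 'I_n}) :=
  [exists u in A, exists v in A, (u < v) && col (val u, val v)].
apply/(mono_copyP E_wf (c := c)) => // u v uv.
apply/exists_inP/idP => [[x] | col_uv].
  move=> /set2P[] -> /exists_inP[y] /set2P[] -> /andP[] //; rewrite ?ltnn //.
  by rewrite ltnNge ltnW.
by exists u; rewrite ?set21 //; apply/exists_inP; exists v; rewrite ?set22 ?uv.
Qed.

(** * Refutation by branching and unit propagation *)

Section Tables.
Variables (T : Type) (x0 : T).
Implicit Types (t : seq (seq T)) (e : nat * nat).

Definition lookup t e : T := nth x0 (nth [::] t e.2) e.1.

Definition update t e x : seq (seq T) :=
  set_nth [::] t e.2 (set_nth x0 (nth [::] t e.2) e.1 x).

Lemma lookup_update t e x e' :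
  lookup (update t e x) e' = if e' == e then x else lookup t e'.
Proof.
case: e e' => [i j] [i' j']; rewrite xpair_eqE /lookup nth_set_nth /=.
have [->|_] := eqVneq j' j; rewrite ?andbF ?andbT //.
by rewrite nth_set_nth /=; case: eqP.
Qed.

End Tables.

Section Refutation.
Variables (Fs : seq edges) (incident : nat * nat -> seq edges).
Hypothesis incident_sub : forall e, {subset incident e <= Fs}.

(* The colour of the edge (i, j) is stored at index i of row j. *)
Definition partial_colouring := seq (seq (option bool)).
Implicit Types (a : partial_colouring) (b : bool) (e : nat * nat) (F : edges).

Definition extends (col : colouring) a :=
  forall e b, lookup None a e = Some b -> col e = b.

Lemma extends_nil col : extends col [::].
Proof. by move=> e b; rewrite /lookup !nth_nil. Qed.

Lemma extends_update col a e b :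
  extends col a -> col e = b -> extends col (update None a e (Some b)).
Proof.
move=> ext col_e e' b'; rewrite lookup_update.
by case: eqP => [-> [<-] | _ /ext].
Qed.

Definition assignment := (nat * nat * bool)%type.

Definition has_colour a b e :=
  if lookup None a e is Some b' then b' == b else false.

(* If all edges of F have colour b, then contradictory colours are forced. *)
Definition forced a b F : seq assignment :=
  match [seq e <- F | ~~ has_colour a b e] with
  | [::] => [seq (e, ~~ b) | e <- F]
  | [:: e] => [:: (e, ~~ b)]
  | _ => [::]
  end.

(* Returns None if two assignments conflict.  If the fuel runs out, consequences
   are missed, but the answer stays sound. *)
Fixpoint propagate (fuel : nat) a (queue : seq assignment) :
    option partial_colouring :=
  match fuel, queue with
  | fuel'.+1, (e, b) :: queue' =>
    if lookup None a e is Some b' then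
      if b' == b then propagate fuel' a queue' else None
    else
      let a' := update None a e (Some b) in
      propagate fuel' a'
        (queue' ++ flatten [seq forced a' b F | F <- incident e])
  | _, _ => Some a
  end.

Fixpoint refutes (fuel : nat) (order : edges) a (first : assignment) : bool :=
  if propagate fuel a [:: first] is Some a' then
    if order is e :: order' then
      refutes fuel order' a' (e, false) && refutes fuel order' a' (e, true)
    else false
  else true.

Section Soundness.
Variable col : colouring.
Hypothesis col_avoids : avoids col Fs.

Lemma forced_sound a b F e b' : F \in Fs -> extends col a ->
  (e, b') \in forced a b F -> col e = b'.
Proof.
move=> FsF ext; rewrite /forced.
have /allPn[e' Fe' col_e'] := avoidsP _ _ col_avoids F b FsF.
have : e' \in [seq e <- F | ~~ has_colour a b e].
  rewrite mem_filter Fe' andbT /has_colour.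
  by case def_e': (lookup None a e') => [b''|] //; rewrite -(ext _ _ def_e').
case: filter => [|e1 [|]] //; rewrite !mem_seq1 => /eqP eq_e' /eqP[-> ->].
by move: col_e'; rewrite eq_e'; case: (col _) (b) => [] [].
Qed.

Lemma propagate_sound fuel a queue : extends col a ->
    (forall e b, (e, b) \in queue -> col e = b) ->
  exists2 a', propagate fuel a queue = Some a' & extends col a'.
Proof.
elim: fuel a queue => [|fuel IHfuel] a [|[e b] queue] /=; try by exists a.
move=> ext q_sound; have col_e : col e = b by apply/q_sound/mem_head.
have q'_sound e' b' : (e', b') \in queue -> col e' = b'.
  by move=> q_e'; apply: q_sound; rewrite in_cons q_e' orbT.
case def_e: (lookup None a e) => [b'|].
  by rewrite -(ext _ _ def_e) col_e eqxx; exact: IHfuel.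
have ext' := extends_update ext col_e.
apply: IHfuel => // e' b'; rewrite mem_cat => /orP[/q'_sound // | ].
by case/flatten_mapP=> F /incident_sub FsF; exact: forced_sound.
Qed.

Lemma propagate_single fuel a e : extends col a ->
  exists2 a', propagate fuel a [:: (e, col e)] = Some a' & extends col a'.
Proof.
move=> ext; apply: propagate_sound => // e' b'.
by rewrite mem_seq1 => /eqP[-> ->].
Qed.

Lemma refutes_sound fuel order a e :
  extends col a -> ~~ refutes fuel order a (e, col e).
Proof.
elim: order a e => [|e' order IHorder] a e ext /=;
  have [a' -> ext'] := propagate_single fuel e ext; first by [].
by have := IHorder _ e' ext'; case: (col e') => /negbTE->; rewrite ?andbF.
Qed.
End Soundness.
End Refutation.

Definition incidence (n : nat) (Fs : seq edges) : seq (seq (seq edges)) :=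
  [seq [seq [seq F <- Fs | (i, j) \in F] | i <- iota 0 j] | j <- iota 0 n].

Lemma incidence_sub n Fs e : {subset lookup [::] (incidence n Fs) e <= Fs}.
Proof.
rewrite /lookup /incidence => F.
have [lt_j|le_j] := ltnP e.2 n; last first.
  by rewrite [nth _ _ e.2]nth_default ?nth_nil // size_map size_iota.
rewrite (nth_map 0) ?size_iota // nth_iota // add0n.
have [lt_i|le_i] := ltnP e.1 e.2; last first.
  by rewrite nth_default // size_map size_iota.
by rewrite (nth_map 0) ?size_iota // mem_filter => /andP[].
Qed.

Lemma avoids_negb col Fs : avoids (fun e => ~~ col e) Fs = avoids col Fs.
Proof.
have mono_negb b F :
    monochromatic (fun e => ~~ col e) b F = monochromatic col (~~ b) F.
  by apply: eq_all => e; case: (col e) b => [] [].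
by apply: eq_all => F; rewrite !mono_negb andbC.
Qed.

(* Exchanging the colours, we may assume that the first edge has colour true.
   The fuel suffices because every incidence of an edge with a hyperedge
   enqueues at most one assignment before a conflict arises. *)
Definition refuted (n : nat) (Fs : seq edges) (order : edges) :=
  if order is e :: order' then
    refutes (lookup [::] (incidence n Fs))
      (size (flatten Fs)).+1 order' [::] (e, true)
  else false.

Lemma refutedP n Fs order col : refuted n Fs order -> ~~ avoids col Fs.
Proof.
case: order => // e order; wlog col_e : col / col e = true => [col_true ref | ].
  case col_e: (col e); first exact: col_true.
  by rewrite -avoids_negb col_true //= col_e.
rewrite /refuted -col_e; apply: contraL => col_avoids.
exact: (refutes_sound (@incidence_sub n Fs) col_avoids) (extends_nil col).
Qed.

(** * Cliques in two-coloured complete graphs *)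

Lemma even_sum_degrees (T : finType) (r : rel T) (A : {set T}) :
    symmetric r -> irreflexive r ->
  ~~ odd (\sum_(x in A) #|[set y in A | r x y]|).
Proof.
move=> r_sym r_irr; pose before (x y : T) := enum_rank x < enum_rank y.
have -> : \sum_(x in A) #|[set y in A | r x y]| =
    (\sum_(x in A) \sum_(y in A | r x y && before x y) 1).*2.
  rewrite -addnn {2}(exchange_big_dep (mem A)) /=; last by move=> ? ? _ /andP[].
  rewrite -big_split /=; apply: eq_bigr => x xA.
  have after_x y : r x y -> ~~ before x y = before y x.
    move=> r_xy; rewrite /before -leqNgt leq_eqVlt orb_idl // => /eqP/val_inj.
    by move/enum_rank_inj=> eq_yx; rewrite eq_yx r_irr in r_xy.
  rewrite -sum1_card (bigID (before x)) /=; congr (_ + _);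
    apply: eq_bigl => y; rewrite !inE ?xA -?andbA //=.
  by rewrite [r y x]r_sym; have [/after_x->|] := boolP (r x y).
by rewrite odd_double.
Qed.

Section Cliques.
Variables (T : finType) (c : {set T} -> bool).
Implicit Types (A B S : {set T}) (b : bool) (k l p q : nat).

Definition has_clique b k A := exists S : {set T},
  [/\ S \subset A, k <= #|S|
    & {in S &, forall x y, x != y -> c [set x; y] = b}].

Definition nbrs b x A := [set y in A | (y != x) && (c [set x; y] == b)].

Lemma has_cliqueS b k A B : A \subset B -> has_clique b k A -> has_clique b k B.
Proof. by move=> sAB [S [sSA ? ?]]; exists S; rewrite (subset_trans sSA). Qed.

Lemma nbrs_sub b x A : nbrs b x A \subset A.
Proof. by apply/subsetP => y; rewrite inE => /andP[]. Qed.

Lemma has_clique_nbrs b k x A :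
  x \in A -> has_clique b k (nbrs b x A) -> has_clique b k.+1 A.
Proof.
move=> xA [S [sSN card_S S_mono]].
have nbr y : y \in S -> y != x /\ c [set x; y] = b.
  by move/(subsetP sSN); rewrite inE => /and3P[_ ? /eqP].
exists (x |: S); split.
- by rewrite subUset sub1set xA (subset_trans sSN (nbrs_sub b x A)).
- rewrite cardsU1; have [/nbr[] | //] := boolP (x \in S).
  by rewrite eqxx.
move=> y z /setU1P[->|yS] /setU1P[->|zS]; rewrite ?eqxx //.
- by move=> _; have [] := nbr z zS.
- by move=> _; rewrite setUC; have [] := nbr y yS.
- exact: S_mono.
Qed.

Lemma card_nbrs b x A : x \in A ->
  #|A| = (#|nbrs b x A| + #|nbrs (~~ b) x A|).+1.
Proof.
move=> xA; rewrite (cardsD1 x) xA add1n; congr _.+1.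
rewrite -(cardsID [set y | c [set x; y] == b] (A :\ x)); congr (_ + _);
  apply: eq_card => y; rewrite !inE; first by rewrite andbCA andbA.
by case: (c _) b => [] []; rewrite /= ?andbT ?andbF // andbC.
Qed.

Lemma even_sum_nbrs b A : ~~ odd (\sum_(x in A) #|nbrs b x A|).
Proof.
apply: (@even_sum_degrees _ [rel x y | (y != x) && (c [set x; y] == b)]).
  by move=> x y /=; rewrite eq_sym setUC.
by move=> x /=; rewrite eqxx.
Qed.

Definition arrows p k l := forall b A,
  p <= #|A| -> has_clique b k A \/ has_clique (~~ b) l A.

Lemma arrowsC p k l : arrows p k l -> arrows p l k.
Proof. by move=> arr b A /(arr (~~ b)); rewrite negbK => /or_comm. Qed.

Lemma arrows_2l k : arrows k 2 k.
Proof.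
move=> b A card_A.
have [/exists_inP[x xA /exists_inP[y yA /andP[xy /eqP cxy]]] | ] := boolP
  [exists x in A, exists y in A, (x != y) && (c [set x; y] == b)].
  left; exists [set x; y]; split; rewrite ?cards2 ?xy //.
    by rewrite subUset !sub1set xA.
  by move=> u v /set2P[]-> /set2P[]->; rewrite ?eqxx // => _; rewrite // setUC.
rewrite negb_exists_in => /forall_inP no_edge; right; exists A.
split=> // x y xA yA xy.
have := no_edge x xA; rewrite negb_exists_in => /forall_inP /(_ y yA).
by rewrite xy; case: (c _) (b) => [] [].
Qed.

Section Recursion.
Variables (p q k l : nat).
Hypotheses (arr_p : arrows p.+1 k l.+1) (arr_q : arrows q.+1 k.+1 l).

Lemma arrows_nbrs b A x :
    x \in A -> (p < #|nbrs b x A|) || (q < #|nbrs (~~ b) x A|) ->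
  has_clique b k.+1 A \/ has_clique (~~ b) l.+1 A.
Proof.
have sub b' := has_cliqueS (nbrs_sub b' x A).
move=> xA /orP[/(arr_p b)[clq|clq]|/(arr_q b)[clq|clq]].
- by left; apply: has_clique_nbrs clq.
- by right; apply: sub clq.
- by left; apply: sub clq.
- by right; apply: has_clique_nbrs clq.
Qed.

Lemma arrowsS : arrows (p + q).+2 k.+1 l.+1.
Proof.
move=> b A card_A.
have [x xA] : exists x, x \in A by apply/card_gt0P/(leq_trans _ card_A).
apply: (arrows_nbrs xA); move: card_A; rewrite (card_nbrs b xA) !ltnS.
by apply: contraLR; rewrite negb_or -!ltnNge !ltnS => /andP[]; exact: leq_add.
Qed.

(* Otherwise A has exactly p + q + 1 vertices, all of degree p in colour b. *)
Lemma arrowsS_odd : odd p -> odd q -> arrows (p + q).+1 k.+1 l.+1.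
Proof.
move=> odd_p odd_q b A card_A.
have [/exists_inP[x xA] | ] := boolP [exists x in A,
    (p < #|nbrs b x A|) || (q < #|nbrs (~~ b) x A|)]; first exact: arrows_nbrs.
rewrite negb_exists_in => /forall_inP small.
have regular x : x \in A -> #|nbrs b x A| = p /\ #|A| = (p + q).+1.
  move=> xA; have := small x xA; move: card_A; rewrite (card_nbrs b xA) !ltnS.
  rewrite negb_or -!leqNgt => le_pq /andP[le_p le_q].
  split; apply/eqP; last by rewrite eqSS eqn_leq leq_add.
  by rewrite eqn_leq le_p -(leq_add2r q) (leq_trans le_pq) ?leq_add2l.
have [x xA] : exists x, x \in A by apply/card_gt0P/(leq_trans _ card_A).
have := even_sum_nbrs b A; rewrite (eq_bigr (fun=> p)) => [|y /regular[] //].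
by rewrite sum_nat_const (regular x xA).2 oddM /= oddD odd_p odd_q.
Qed.

End Recursion.

Lemma arrows_4_4 : arrows 18 4 4.
Proof.
have arr_3_3 : arrows 6 3 3.
  exact: (arrowsS (p := 2) (q := 2)) (@arrows_2l 3) (arrowsC (@arrows_2l 3)).
have arr_3_4 : arrows 9 3 4.
  exact: (arrowsS_odd (p := 3) (q := 5)) (@arrows_2l 4) arr_3_3 _ _.
exact: (arrowsS (p := 8) (q := 8)) arr_3_4 (arrowsC arr_3_4).
Qed.

End Cliques.

Lemma has_clique_mono_copy n (c : {set 'I_n} -> bool) b m (G : ordGraph m) A :
  has_clique c b m A -> mono_copy G c.
Proof.
move=> [S [_ card_S S_mono]].
pose f (i : 'I_m) : 'I_n := Order.enum_val (widen_ord card_S i).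
have f_mono : {mono f : i j / i < j}.
  move=> i j; rewrite ltnNge [RHS]ltnNge; congr (~~ _).
  exact: (@Order.le_enum_val _ 'I_n leq_total S).
exists f, b; split=> // i j Gij; apply: S_mono; rewrite ?Order.enum_valP //.
apply: contraTneq Gij => /Order.enum_val_inj[] /val_inj->.
by rewrite adj_irr.
Qed.

Lemma arrows_ramsey_for m (G : ordGraph m) n :
  (forall c : {set 'I_n} -> bool, arrows c n m m) -> ramsey_for G n.
Proof.
move=> arr c; have card_T : n <= #|[set: 'I_n]| by rewrite cardsT card_ord.
by have [] := arr c true setT card_T; exact: has_clique_mono_copy.
Qed.

(** * Ordered graphs on at most four vertices *)

Definition adjacent (E : edges) : rel nat := fun i j =>
  (i != j) && (((i.+1, j.+1) \in E) || ((j.+1, i.+1) \in E)).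

Definition equal_below (m : nat) (g h : rel nat) :=
  all (fun i => all (fun j => g i j == h i j) (iota 0 m)) (iota 0 m).

Definition isomorphic_below (m : nat) (g h : rel nat) :=
  has (fun s => equal_below m g (fun i j => h (nth 0 s i) (nth 0 s j)))
      (permutations (iota 0 m)).

Definition mirror (m : nat) (g : rel nat) : rel nat :=
  fun i j => g (m - i.+1) (m - j.+1).

Definition spanning_below (m : nat) (g : rel nat) :=
  all (fun v => has (g v) (iota 0 m)) (iota 0 m).

Lemma equal_belowP m (g h : rel nat) :
  reflect (forall i j : 'I_m, g i j = h i j) (equal_below m g h).
Proof.
apply: (iffP allP) => [eq_gh i j | eq_gh i].
  by apply/eqP/(allP (eq_gh i _)); rewrite mem_iota /=.
rewrite mem_iota => /= lt_i; apply/allP => j; rewrite mem_iota => /= lt_j.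
exact/eqP/(eq_gh (Ordinal lt_i) (Ordinal lt_j)).
Qed.

Definition represents m (G : ordGraph m) (g : rel nat) :=
  forall i j : 'I_m, G i j = g i j.

Lemma represents_graph_of m E : represents (graph_of m E) (adjacent E).
Proof. by []. Qed.

Lemma mono_ord_geq m (u : 'I_m -> 'I_m) (i : 'I_m) :
  {mono u : j k / j < k} -> i <= u i.
Proof.
move=> u_mono; case: i; elim=> // i IHi lt_i.
by apply: leq_ltn_trans (IHi (ltnW lt_i)) _; rewrite u_mono.
Qed.

Lemma mono_bij_ord_id m (f : 'I_m -> 'I_m) :
  bijective f -> {mono f : i j / i < j} -> f =1 id.
Proof.
move=> [k fK kK] f_mono i; have k_mono : {mono k : j l / j < l}.
  by move=> j l; rewrite -f_mono !kK.
apply/val_inj/eqP; rewrite eqn_leq (mono_ord_geq i f_mono) andbT.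
by rewrite -{2}[i]fK mono_ord_geq.
Qed.

Section Represented.
Variables (m : nat) (G H : ordGraph m) (g h : rel nat).
Hypotheses (Gg : represents G g) (Hh : represents H h).

Lemma represents_reflection : represents (reflection G) (mirror m g).
Proof. by move=> i j; rewrite /= /refl_rel Gg. Qed.

Lemma no_isolatedP : no_isolated G <-> spanning_below m g.
Proof.
split=> [iso | /allP span v].
  apply/allP => i; rewrite mem_iota => /= lt_i.
  have [w vw] := iso (Ordinal lt_i); apply/hasP; exists (val w).
    by rewrite mem_iota /=.
  by rewrite Gg in vw.
have /hasP[j] : has (g v) (iota 0 m) by apply: span; rewrite mem_iota /=.
by rewrite mem_iota => /= lt_j adj_vj; exists (Ordinal lt_j); rewrite Gg.
Qed.

Lemma ordering_ofP : ordering_of G H <-> isomorphic_below m g h.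
Proof.
split=> [[f f_bij f_iso] | /hasP[s]].
  pose s := map val [seq f i | i <- enum 'I_m].
  have nth_s (i : 'I_m) : nth 0 s i = f i.
    by rewrite /s -map_comp (nth_map i) ?size_enum_ord // nth_ord_enum.
  apply/hasP; exists s; last first.
    by apply/equal_belowP => i j; rewrite !nth_s -Gg -Hh f_iso.
  rewrite mem_permutations -val_enum_ord; apply/perm_map/uniq_perm.
  - by rewrite map_inj_uniq ?enum_uniq //; exact: bij_inj.
  - exact: enum_uniq.
  - case: f_bij => k _ kK i; rewrite mem_enum inE; apply/mapP.
    by exists (k i); rewrite ?mem_enum ?kK.
rewrite mem_permutations => perm_s /equal_belowP s_iso.
have sz_s : size s = m by rewrite (perm_size perm_s) size_iota.
have lt_s (i : 'I_m) : nth 0 s i < m.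
  have : nth 0 s i \in iota 0 m by rewrite -(perm_mem perm_s) mem_nth ?sz_s.
  by rewrite mem_iota.
exists (fun i => Ordinal (lt_s i)) => [|i j]; last by rewrite Gg Hh s_iso.
apply: injF_bij => i j [] /eqP.
by rewrite nth_uniq ?sz_s ?(perm_uniq perm_s) ?iota_uniq // => /eqP/val_inj.
Qed.

Lemma ord_isoP : ord_iso G H <-> equal_below m g h.
Proof.
split=> [[f [f_bij f_mono f_iso]] | /equal_belowP gh].
  by apply/equal_belowP => i j; rewrite -Gg -Hh -f_iso !mono_bij_ord_id.
exists id; split=> // [|i j]; first by exists id.
by rewrite Gg Hh gh.
Qed.

End Represented.

Lemma same_up_to_reflectionP m (G H : ordGraph m) g h :
    represents G g -> represents H h ->
  same_up_to_reflection G H <->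
  equal_below m g h || equal_below m (mirror m g) h.
Proof.
move=> Gg Hh; have G'g := represents_reflection Gg.
split=> [[/(ord_isoP Gg Hh)->|/(ord_isoP G'g Hh)->] | /orP[]]; rewrite ?orbT //.
  by move/(ord_isoP Gg Hh); left.
by move/(ord_isoP G'g Hh); right.
Qed.

Lemma bij_ord_eq m n (f : 'I_m -> 'I_n) : bijective f -> m = n.
Proof. by move=> /bij_eq_card; rewrite !card_ord. Qed.

Definition matches (m : nat) (g : rel nat) (x : row) :=
  (nverts x == m) && (equal_below m g (adjacent (edgeset x))
                      || equal_below m (mirror m g) (adjacent (edgeset x))).

Lemma matchesP m (G : ordGraph m) g x : represents G g ->
  same_up_to_reflection G (row_graph x) <-> matches m g x.
Proof.
move=> Gg; rewrite /matches; have [|neq_m] := eqVneq; last first.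
  by split=> // -[] [f [/bij_ord_eq eq_m _ _]]; rewrite eq_m eqxx in neq_m.
case: x => k F E r /= eq_k; subst m.
exact: (same_up_to_reflectionP Gg (@represents_graph_of _ E)).
Qed.

Lemma exists_unique_count (T : eqType) (s : seq T) (p : pred T)
    (P : T -> Prop) :
    uniq s -> (forall x, P x <-> p x) ->
  (exists! x, x \in s /\ P x) <-> count p s == 1.
Proof.
move=> uniq_s Pp; rewrite -size_filter.
have mem_p x : x \in filter p s <-> x \in s /\ P x.
  by rewrite mem_filter; split=> [/andP[/Pp px xs] | [-> /Pp->]].
split=> [[x [/mem_p x_in x_uniq]] | ].
  suff /perm_size-> : perm_eq (filter p s) [:: x] by [].
  apply: uniq_perm => [||y]; rewrite ?filter_uniq // inE.
  by apply/idP/eqP => [/mem_p /x_uniq-> | -> //].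
case def_f: (filter p s) => [|x [|]] // _.
exists x; split=> [|y /mem_p]; last by rewrite def_f inE => /eqP.
by apply/mem_p; rewrite def_f inE.
Qed.

Definition pairs (m : nat) : edges :=
  [seq (i.+1, j.+1) | j <- iota 0 m, i <- iota 0 j].

Lemma mem_pairs m i j : ((i.+1, j.+1) \in pairs m) = (i < j < m).
Proof.
apply/allpairsPdep/andP => [[j' [i' [+ + [-> ->]]]] | [lt_ij lt_jm]].
  by rewrite !mem_iota.
by exists j, i; rewrite !mem_iota.
Qed.

Definition joins m (G : ordGraph m) (e : nat * nat) : bool :=
  [exists i : 'I_m, exists j : 'I_m, [&& G i j, i.+1 == e.1 & j.+1 == e.2]].

Definition edges_of m (G : ordGraph m) : edges := filter (joins G) (pairs m).

Lemma mem_edges_of m (G : ordGraph m) (i j : 'I_m) :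
  ((i.+1, j.+1) \in edges_of G) = (i < j) && G i j.
Proof.
rewrite mem_filter mem_pairs ltn_ord andbT andbC; congr (_ && _).
apply/existsP/idP => [[i' /existsP[j' /and3P[Gij]]] | Gij].
  by rewrite !eqSS !val_eqE => /eqP<- /eqP<-.
by exists i; apply/existsP; exists j; rewrite Gij !eqxx.
Qed.

Lemma represents_edges_of m (G : ordGraph m) :
  represents G (adjacent (edges_of G)).
Proof.
move=> i j; rewrite /adjacent !mem_edges_of (adj_sym G j i).
by case: (ltngtP i j) => // [_ | /val_inj->]; rewrite ?orbF ?adj_irr.
Qed.

Definition K4minus_edges : edges := [:: (1,2); (1,3); (1,4); (2,3); (2,4)].

Definition isomorphic_K4minus (m : nat) (g : rel nat) :=
  (m == 4) && isomorphic_below m g (adjacent K4minus_edges).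

Lemma isomorphic_K4minusP m (G : ordGraph m) g : represents G g ->
  ordering_of G K4minus <-> isomorphic_K4minus m g.
Proof.
move=> Gg; rewrite /isomorphic_K4minus.
have [eq_m | neq_m] := eqVneq; last first.
  by split=> // -[f /bij_ord_eq eq_m _]; rewrite eq_m eqxx in neq_m.
by subst m; exact: (ordering_ofP Gg (@represents_graph_of 4 K4minus_edges)).
Qed.

Definition classified (m : nat) (g : rel nat) :=
  (spanning_below m g && ~~ isomorphic_K4minus m g)
  == (count (matches m g) table == 1).

Lemma all_classified :
  all (fun m => all (classified m \o adjacent) (sublists (pairs m)))
      [:: 1; 2; 3; 4].
Proof. by vm_compute. Qed.

Lemma uniq_table : uniq table. Proof. by vm_compute. Qed.

Lemma table_complete m (G : ordGraph m) : 0 < m <= 4 ->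
  (no_isolated G /\ ~ ordering_of G K4minus) <->
  exists! x : row, x \in table /\ same_up_to_reflection G (row_graph x).
Proof.
move=> m_le4; have Gg := represents_edges_of G.
have m_in : m \in [:: 1; 2; 3; 4] by rewrite -[_ :: _]/(iota 1 4) mem_iota.
have E_in : edges_of G \in sublists (pairs m).
  by rewrite mem_sublists filter_subseq.
have /eqP count1 := allP (allP all_classified m m_in) _ E_in.
apply: iff_trans (iff_sym (exists_unique_count uniq_table
  (fun x => matchesP x Gg))); rewrite -{}count1.
split=> [[/(no_isolatedP Gg)-> no_K4] | /andP[/(no_isolatedP Gg) iso no_K4]].
  by apply/negP => /(isomorphic_K4minusP Gg).
by split=> // /(isomorphic_K4minusP Gg); apply/negP.
Qed.

(** * The values in the table *)

(* Bit i of the number in position j is the colour of the edge (i, j). *)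
Definition colouring_of_rows (rows : seq N) : colouring :=
  fun e => N.testbit_nat (nth 0%num rows e.2) e.1.

(* The nonzero squares modulo 17. *)
Definition paley_colouring : colouring :=
  fun e => e.2 - e.1 \in [:: 1; 2; 4; 8; 9; 13; 15; 16].

Definition critical_colourings : seq colouring :=
  rcons (map colouring_of_rows [::
    [:: 0];
    [:: 0; 0; 2];
    [:: 0; 0; 3; 2];
    [:: 0; 1; 0; 5; 6];
    [:: 0; 0; 0; 1; 3];
    [:: 0; 0; 0; 2];
    [:: 0; 1; 3; 0; 0];
    [:: 0; 0; 0; 1; 3; 30; 7; 92];
    [:: 0; 0; 2; 6; 4; 9];
    [:: 0; 0; 0; 4; 7; 15; 12; 70];
    [:: 0; 0; 1; 1; 4; 14];
    [:: 0; 0; 0; 3; 2; 9];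
    [:: 0; 0; 0; 7; 15; 6; 6; 38];
    [:: 0; 1; 0; 0; 12; 8; 63; 60; 40];
    [:: 0; 0; 0; 4; 12; 19; 51; 15; 15];
    [:: 0; 0; 0; 4; 6];
    [:: 0; 0; 2; 0; 11; 15; 8; 72];
    [:: 0; 0; 2; 0; 8; 11; 56; 37; 147];
    [:: 0; 0; 2; 4; 8; 27; 31; 6; 146];
    [:: 0; 0; 0; 4; 12; 3; 21; 15; 90];
    [:: 0; 0; 2; 5; 1; 23; 16; 112; 206; 87];
    [:: 0; 1; 0; 0; 4; 8; 63; 28; 168; 52];
    [:: 0; 1; 3; 4; 5; 3; 48; 104; 202];
    [:: 0; 0; 1; 4; 3; 26; 21; 102; 41];
    [:: 0; 0; 3; 2; 15; 10; 60; 41; 3; 496; 421; 271; 4032];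
    [:: 0; 0; 0; 4; 11; 31; 39; 28; 31; 134]]%num)
  paley_colouring.

(* These short lists were found by local search.  They leave out K_4, for which
   such a refutation would be too long. *)
Definition branching_orders : seq edges := [::
  [:: (0,1)];
  [:: (0,1); (1,3)];
  [:: (0,4); (1,4)];
  [:: (4,5); (3,5); (2,5); (1,5); (0,5)];
  [:: (3,5); (1,4)];
  [:: (3,4); (2,4)];
  [:: (0,5); (0,1)];
  [:: (6,7); (7,8); (2,7); (2,8)];
  [:: (3,5); (3,4); (0,6)];
  [:: (6,8); (5,8); (2,7)];
  [:: (3,4); (2,4); (1,4)];
  [:: (0,6); (0,5); (0,3)];
  [:: (7,8); (6,8); (5,8)];
  [:: (7,8); (8,9); (1,3); (0,1); (5,7); (5,8); (2,4)];
  [:: (4,9); (8,9); (0,1)];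
  [:: (4,5); (3,5); (2,5)];
  [:: (3,4); (4,6); (4,7); (2,3); (1,3); (6,8)];
  [:: (4,9); (1,9); (8,9); (7,9); (5,9); (6,9); (2,9)];
  [:: (6,7); (5,6); (2,6); (1,5); (4,6); (3,6); (6,8); (2,7); (6,9); (2,4);
      (8,9); (7,8); (7,9); (2,3); (3,4)];
  [:: (8,9); (1,9); (0,9); (2,9); (3,9); (6,9); (4,9); (5,9)];
  [:: (2,4); (0,4); (4,7); (1,4); (4,8); (7,8); (4,9); (3,4); (4,10); (4,5);
      (4,6); (8,9); (5,8); (6,8); (1,8); (6,7); (9,10); (1,6); (2,8); (1,5);
      (2,5)];
  [:: (4,5); (5,6); (7,8); (7,9); (6,7); (4,6); (7,10); (5,7); (2,4); (3,4);
      (3,5); (2,3); (2,5); (1,3); (3,6); (1,2); (4,7); (1,4); (6,10); (0,3);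
      (6,9); (6,8)];
  [:: (7,9); (2,9); (6,9); (0,9); (8,9); (1,9); (4,9); (3,9); (5,9)];
  [:: (6,8); (5,8); (5,7); (5,9); (1,7); (6,7); (4,9); (4,7); (3,7); (4,8);
      (0,8); (6,9); (2,9); (3,8); (3,9)];
  [:: (0,1); (9,11); (0,11); (7,9); (1,2); (1,11); (2,3); (3,5); (5,6); (6,7);
      (1,3); (3,4); (4,5); (8,9); (7,8); (5,7); (10,11); (9,10); (1,5);
      (0,13); (3,7); (2,4); (4,7); (3,10); (10,12)];
  [:: (0,3); (5,10); (0,5); (3,8); (8,10); (0,4); (6,10); (9,10); (5,6);
      (0,1); (1,5); (0,2); (4,6); (5,8); (4,5); (7,10); (2,7); (1,9); (3,9)]].

Lemma table_well_formed :
  all (fun x => well_formed (nverts x) (edgeset x)) table.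
Proof. by vm_compute. Qed.

Lemma table_shapes :
  all (fun x => isomorphic_below (nverts x) (adjacent (edgeset x))
                  (adjacent (Defs.shape x))) table.
Proof. by vm_compute. Qed.

Definition lower_certified (x : row) (col : colouring) :=
  if value x is r.+1 then avoids col (copies (nverts x) (edgeset x) r)
  else false.

Definition upper_certified (x : row) (order : edges) :=
  refuted (value x) (copies (nverts x) (edgeset x) (value x)) order.

Lemma table_lower_certified : all2 lower_certified table critical_colourings.
Proof. by vm_compute. Qed.

Lemma table_upper_certified :
  all2 upper_certified (take 26 table) branching_orders.
Proof. vm_cast_no_check (erefl true). Qed.

Lemma table_ramsey x : x \in table -> ramsey_for (row_graph x) (value x).
Proof.
rewrite -(cat_take_drop 26 table) mem_cat => /orP[x_in | ]; last first.
  by rewrite inE => /eqP->; apply: arrows_ramsey_for => c; exact: arrows_4_4.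
have [order ref] := all2_exists table_upper_certified x_in.
apply/ramsey_forP => [|col]; last exact: refutedP ref.
exact: (allP table_well_formed _ (mem_take x_in)).
Qed.

Lemma table_ordered_ramsey_number x :
  x \in table -> ordered_ramsey_number (row_graph x) (value x).
Proof.
move=> x_in; have [col] := all2_exists table_lower_certified x_in.
have := table_ramsey x_in; rewrite /lower_certified.
case: (value x) => // r ram col_avoids; apply: ordered_ramsey_number_succ => //.
have E_wf := allP table_well_formed x x_in.
by move/(ramsey_forP r E_wf)/(_ col); rewrite col_avoids.
Qed.

Theorem mainTheorem4 :
  (forall x : row, x \in table ->
     ordering_of (row_graph x) (row_shape x) /\
     ordered_ramsey_number (row_graph x) (value x))
  /\
  (forall (m : nat) (G : ordGraph m), 0 < m <= 4 ->
     (no_isolated G /\ ~ ordering_of G K4minus) <->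
     exists! x : row, x \in table /\ same_up_to_reflection G (row_graph x)).
Proof.
split=> [x x_in | m G]; last exact: table_complete.
split; last exact: table_ordered_ramsey_number.
apply/(ordering_ofP (@represents_graph_of _ _) (@represents_graph_of _ _)).
exact: (allP table_shapes).
Qed.
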